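(* Let $k$ be a field, let $n\ge 0$, let $\mathscr{A}$ be a finite set of $k$-rational points of $\mathbb{P}^n$, let $\leq$ be a term order on $k[X_1,\ldots,X_{n+1}]$ with $X_1<\ldots<X_{n+1}$ and $\preceq$ the associated graded order. Let $\gamma$ be the minimum with respect to $\preceq$ of the recursively defined set $\mathscr{C}'$ (at any stage of the recursion at which $\mathscr{C}'\neq\emptyset$). Then $\gamma$ lies in $\mathscr{B}(\mathscr{A})$ if, and only if, the following system in variables $c_\delta\in k$ (for $\delta\in\mathscr{C}(\mathscr{A}_0)$, $|\delta|=|\gamma|$, $\delta\prec\gamma$) and $d_\eta\in k$ (for $\eta\in\mathscr{C}(\mathscr{A}_1)$, $|\eta|=|\gamma|$, $\eta\prec\gamma$) has a solution: $$f_\gamma^{(0)}-f_\gamma^{(1)}=\sum_{\substack{\eta\in\mathscr{C}(\mathscr{A}_1)\\|\eta|=|\gamma|,\ \eta\prec\gamma}}d_\eta f_\eta^{(1)}-\sum_{\substack{\delta\in\mathscr{C}(\mathscr{A}_0)\\|\delta|=|\gamma|,\ \delta\prec\gamma}}c_\delta f_\delta^{(0)},$$ together with the conditions that for all $\xi\in\mathscr{B}(\mathscr{A})$ with $\xi\prec\gamma$: if $\delta\in\xi+\mathbb{N}^{n+1}$ then $c_\delta=0$, and if $\eta\in\xi+\mathbb{N}^{n+1}$ then $d_\eta=0$. In this case, the polynomial $$f_\gamma=f_\gamma^{(0)}+\sum_{\substack{\delta\in\mathscr{C}(\mathscr{A}_0)\\|\delta|=|\gamma|,\ \delta\prec\gamma}}c_\delta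 f_\delta^{(0)}$$ given by a solution lies in $\mathscr{G}(\mathscr{A})$.
   Context: $\mathbb{N}$ contains $0$; $|\gamma|$ is the sum of the components of $\gamma$. The graded order $\preceq$ associated to $\leq$ is: $X^\gamma\prec X^\delta$ iff $|\gamma|<|\delta|$, or $|\gamma|=|\delta|$ and $X^\gamma<X^\delta$; the same symbol is used for the exponents. For a finite set $\mathscr{S}$ of $k$-rational points of $\mathbb{P}^n$ (viewed as lines through $0$ in $\mathbb{A}^{n+1}$), $\mathscr{I}(\mathscr{S})\subset k[X_1,\ldots,X_{n+1}]$ is the homogeneous ideal of all polynomials $f$ vanishing on these lines, i.e. $f(ta_1,\ldots,ta_{n+1})=0$ in $k[t]$ for all $[a_1:\ldots:a_{n+1}]\in\mathscr{S}$. $\mathscr{G}(\mathscr{S})$ is the reduced Gröbner basis of $\mathscr{I}(\mathscr{S})$ w.r.t. $\preceq$; $\mathscr{B}(\mathscr{S})$ is the set of leading exponents of the elements of $\mathscr{G}(\mathscr{S})$; $\mathscr{C}(\mathscr{S})$ is the set of leading exponents of nonzero elements of $\mathscr{I}(\mathscr{S})$; $\mathscr{D}(\mathscr{S})=\mathbb{N}^{n+1}\setminus\mathscr{C}(\mathscr{S})$ (all w.r.t. $\preceq$). $\mathscr{A}_1\subset\mathscr{A}$ is the set of points with nonzero $X_1$-coordinate, and $\mathscr{A}_0=\mathscr{A}\setminus\mathscr{A}_1$ is the set of points with $X_1=0$. For $i\in\{0,1\}$ and $\gamma\in\mathscr{C}(\mathscr{A}_i)$, $f_\gamma^{(i)}$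 denotes the unique monic polynomial in $\mathscr{I}(\mathscr{A}_i)$ with leading exponent $\gamma$ (w.r.t. $\preceq$) all of whose nonleading exponents lie in $\mathscr{D}(\mathscr{A}_i)$. The set $\mathscr{C}'\subset\mathbb{N}^{n+1}$ is defined recursively. Initially $\mathscr{C}'=\mathscr{C}(\mathscr{A}_0)\cap\mathscr{C}(\mathscr{A}_1)$. In each step, as long as $\mathscr{C}'\neq\emptyset$, let $\gamma$ be the minimum of $\mathscr{C}'$ w.r.t. $\preceq$; if $\gamma\in\mathscr{B}(\mathscr{A})$, replace $\mathscr{C}'$ by $\mathscr{C}'\setminus(\gamma+\mathbb{N}^{n+1})$; otherwise replace $\mathscr{C}'$ by $\mathscr{C}'\setminus\{\gamma\}$. *)

(* Defs.v *)
From HB Require Import structures.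
From mathcomp Require Import all_boot all_order all_algebra.
From mathcomp Require Import finmap boolp classical_sets.
From mathcomp.multinomials Require Import mpoly.

Set Implicit Arguments.
Unset Strict Implicit.
Unset Printing Implicit Defensive.

Import GRing.Theory.
Local Open Scope classical_set_scope.
Local Open Scope ring_scope.

(** The [k]-rational points of projective [n]-space are the lines through the
    origin of [k^(n+1)].  The variables X_1, ..., X_{n+1} are indexed by
    ['I_n.+1], so that X_1 is ['X_ord0]. *)
Definition proj_point (k : fieldType) (n : nat) :=
  {L : {vspace 'rV[k]_n.+1} | \dim L == 1%N}.

(** A nonzero vector of the line, i.e. homogeneous coordinates of the point.
    All uses below are invariant under rescaling it. *)
Definition hcoord (k : fieldType) (n : nat) (L : proj_point k n) : 'rV[k]_n.+1 :=
  vpick (val L).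

Lemma hcoord_neq0 (k : fieldType) (n : nat) (L : proj_point k n) : hcoord L != 0.
Proof.
by rewrite /hcoord vpick0 -dimv_eq0 (eqP (valP L)).
Qed.

Lemma hcoord_line (k : fieldType) (n : nat) (L : proj_point k n) :
  <[hcoord L]>%VS = val L.
Proof.
apply/eqP; rewrite eqEdim -memvE memv_pick /= (eqP (valP L)).
by rewrite dim_vline hcoord_neq0.
Qed.

Definition points_X1_neq0 (k : fieldType) (n : nat) (A : {fset proj_point k n}) :
  {fset proj_point k n} := [fset L in A | hcoord L 0 ord0 != 0]%fset.

Definition points_X1_eq0 (k : fieldType) (n : nat) (A : {fset proj_point k n}) :
  {fset proj_point k n} := (A `\` points_X1_neq0 A)%fset.

(** The condition on [L] is [f(t a_1, ..., t a_{n+1}) = 0] in [k[t]]. *)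
Definition vanishing_ideal (k : fieldType) (n : nat)
    (S : {fset proj_point k n}) : set {mpoly k[n.+1]} :=
  [set f | forall L : proj_point k n, L \in S ->
     mmap (@polyC k) (fun i => hcoord L 0 i *: 'X) f = 0].

Definition is_term_order (N : nat) (le : rel 'X_{1..N}) : Prop :=
  [/\ reflexive le, antisymmetric le, transitive le & total le] /\
  [/\ forall m, le 0%MM m &
      forall m1 m2 m3, le m1 m2 -> le (m1 + m3)%MM (m2 + m3)%MM].

Definition increasing_variables (N : nat) (le : rel 'X_{1..N}) : Prop :=
  forall i j : 'I_N, (i < j)%N -> le U_(i)%MM U_(j)%MM && (U_(i)%MM != U_(j)%MM).

(** The graded order associated to [le]. *)
Definition grlt (N : nat) (le : rel 'X_{1..N}) : rel 'X_{1..N} :=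
  fun m1 m2 => (mdeg m1 < mdeg m2)%N ||
    [&& mdeg m1 == mdeg m2, le m1 m2 & m1 != m2].

Definition grle (N : nat) (le : rel 'X_{1..N}) : rel 'X_{1..N} :=
  fun m1 m2 => (m1 == m2) || grlt le m1 m2.

Definition is_gr_min (N : nat) (le : rel 'X_{1..N})
    (E : set 'X_{1..N}) (g : 'X_{1..N}) : Prop :=
  E g /\ forall m, E m -> grle le g m.

(** The cone [g + N^N]; [(_ <= _)%MM] is the componentwise order. *)
Definition cone (N : nat) (g : 'X_{1..N}) : set 'X_{1..N} :=
  [set m | (g <= m)%MM].

(** [m] is the leading exponent of [f] for the graded order; this forces
    [f != 0].  (The library's [mlead] is tied to a fixed monomial order.) *)
Definition is_lead (k : fieldType) (N : nat) (le : rel 'X_{1..N})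
    (f : {mpoly k[N]}) (m : 'X_{1..N}) : Prop :=
  m \in msupp f /\ forall m', m' \in msupp f -> grle le m' m.

Definition lead_exps (k : fieldType) (N : nat) (le : rel 'X_{1..N})
    (I : set {mpoly k[N]}) : set 'X_{1..N} :=
  [set m | exists f, I f /\ is_lead le f m].

Definition is_groebner_basis (k : fieldType) (N : nat) (le : rel 'X_{1..N})
    (I : set {mpoly k[N]}) (G : {fset {mpoly k[N]}}) : Prop :=
  (forall g, g \in G -> I g /\ g != 0) /\
  (forall m, lead_exps le I m ->
     exists g mg, [/\ g \in G, is_lead le g mg & cone mg m]).

Definition is_reduced_groebner_basis (k : fieldType) (N : nat)
    (le : rel 'X_{1..N}) (I : set {mpoly k[N]}) (G : {fset {mpoly k[N]}}) : Prop :=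
  [/\ is_groebner_basis le I G,
      forall g mg, g \in G -> is_lead le g mg -> g@_mg = 1 &
      forall g g' mg' m, g \in G -> g' \in G -> g != g' ->
        is_lead le g' mg' -> m \in msupp g -> ~ cone mg' m].

(** [script_G S], [script_B S], [script_C S], [script_D S] and [fpoly S gamma]
    stand for script G(S), B(S), C(S), D(S) and f_gamma.  [script_G] and [fpoly]
    are definite descriptions: when [le] is a term order, the object described
    exists and is unique (for [fpoly], if gamma lies in [script_C S]), so the
    default values given to [xget] are irrelevant. *)
Definition script_G (k : fieldType) (n : nat) (le : rel 'X_{1..n.+1})
    (S : {fset proj_point k n}) : {fset {mpoly k[n.+1]}} :=
  xget fset0%fset [set G | is_reduced_groebner_basis le (vanishing_ideal S) G].

Definition script_B (k : fieldType) (n : nat) (le : rel 'X_{1..n.+1})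
    (S : {fset proj_point k n}) : set 'X_{1..n.+1} :=
  [set m | exists g, g \in script_G le S /\ is_lead le g m].

Definition script_C (k : fieldType) (n : nat) (le : rel 'X_{1..n.+1})
    (S : {fset proj_point k n}) : set 'X_{1..n.+1} :=
  lead_exps le (vanishing_ideal S).

Definition script_D (k : fieldType) (n : nat) (le : rel 'X_{1..n.+1})
    (S : {fset proj_point k n}) : set 'X_{1..n.+1} := ~` script_C le S.

Definition is_fpoly (k : fieldType) (n : nat) (le : rel 'X_{1..n.+1})
    (S : {fset proj_point k n}) (g : 'X_{1..n.+1}) (f : {mpoly k[n.+1]}) : Prop :=
  [/\ vanishing_ideal S f, is_lead le f g, f@_g = 1 &
      forall m, m \in msupp f -> m <> g -> script_D le S m].

Definition fpoly (k : fieldType) (n : nat) (le : rel 'X_{1..n.+1})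
    (S : {fset proj_point k n}) (g : 'X_{1..n.+1}) : {mpoly k[n.+1]} :=
  xget 0 [set f | is_fpoly le S g f].

(** [cprime_stage le A E]: the set [E] is a value taken by C' after finitely
    many steps of the recursion. *)
Inductive cprime_stage (k : fieldType) (n : nat) (le : rel 'X_{1..n.+1})
    (A : {fset proj_point k n}) : set 'X_{1..n.+1} -> Prop :=
| cprime_init :
    cprime_stage le A
      (script_C le (points_X1_eq0 A) `&` script_C le (points_X1_neq0 A))
| cprime_cone (E : set 'X_{1..n.+1}) (g : 'X_{1..n.+1}) :
    cprime_stage le A E -> is_gr_min le E g -> script_B le A g ->
    cprime_stage le A (E `\` cone g)
| cprime_point (E : set 'X_{1..n.+1}) (g : 'X_{1..n.+1}) :
    cprime_stage le A E -> is_gr_min le E g -> ~ script_B le A g ->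
    cprime_stage le A (E `\` [set g]).

(** The exponents [d] in [script_C le S] with [|d| = |g|] and [d] below [g]. *)
Definition lower_exps (k : fieldType) (n : nat) (le : rel 'X_{1..n.+1})
    (S : {fset proj_point k n}) (g : 'X_{1..n.+1}) : set 'X_{1..n.+1} :=
  [set d | [/\ script_C le S d, mdeg d = mdeg g & grlt le d g]].

(** The sum of [c d *: fpoly le S d] over [lower_exps le S g].  The index type,
    the exponents of degree at most [|g|], is only there to make it finite. *)
Definition lower_sum (k : fieldType) (n : nat) (le : rel 'X_{1..n.+1})
    (S : {fset proj_point k n}) (g : 'X_{1..n.+1})
    (c : 'X_{1..n.+1} -> k) : {mpoly k[n.+1]} :=
  \sum_(d : 'X_{1..n.+1 < (mdeg g).+1} | `[< lower_exps le S g (bmnm d) >])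
     c (bmnm d) *: fpoly le S (bmnm d).

(** Only the values of [c] and [d] on the respective index sets
    [lower_exps le _ g] are constrained. *)
Definition is_solution (k : fieldType) (n : nat) (le : rel 'X_{1..n.+1})
    (A : {fset proj_point k n}) (g : 'X_{1..n.+1})
    (c d : 'X_{1..n.+1} -> k) : Prop :=
  let A0 := points_X1_eq0 A in
  let A1 := points_X1_neq0 A in
  fpoly le A0 g - fpoly le A1 g = lower_sum le A1 g d - lower_sum le A0 g c /\
  forall xi, script_B le A xi -> grlt le xi g ->
    (forall delta, lower_exps le A0 g delta -> cone xi delta -> c delta = 0) /\
    (forall eta, lower_exps le A1 g eta -> cone xi eta -> d eta = 0).

(* Main.v *)
Require Import Defs.
From mathcomp Require Import all_boot all_order all_algebra.
From mathcomp Require Import finmap boolp classical_sets.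
From mathcomp.multinomials Require Import mpoly.

Set Implicit Arguments.
Unset Strict Implicit.
Unset Printing Implicit Defensive.

Import GRing.Theory.
Local Open Scope classical_set_scope.
Local Open Scope ring_scope.

(** Write I, I0, I1 for the ideals of the points of [A], of those with X_1 = 0 and
    of those with X_1 <> 0, and C, C0, C1 for their sets of leading exponents, so
    that I is the intersection of I0 and I1, and C lies in both C0 and C1.

    A polynomial of an ideal none of whose exponents is a leading exponent of that
    ideal is zero ([ideal_eq0]).  So an element p of I0 is determined by its
    coefficients at the exponents in C0: if it is monic with leading exponent gamma
    and homogeneous, then p is f_gamma^(0) plus the sum of p_delta f_delta^(0) over
    delta in C0 below gamma ([lower_expansion]); likewise for I1.

    If gamma is in B(A), the basis element with leading exponent gamma is such a p
    for both ideals.  Equating its two expansions gives the linear system, and the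
    vanishing conditions on the coefficients say that a reduced basis element has no
    nonleading exponent in C ([script_B_solution]).

    Conversely the system says that a polynomial f of I0 equals one of I1, so f is in
    I; it is monic with leading exponent gamma, and the vanishing conditions keep its
    other exponents out of C ([solution_reduced_at]).  Hence gamma is in C.  It is a
    minimal element of C because the recursion only ever removes an element of B(A)
    together with its whole cone ([cprime_stage_cone]), so that no generator below
    the current minimum can divide it.  So gamma is in B(A), and f and the basis
    element with leading exponent gamma are both reduced, hence equal.

    Since f_gamma and the reduced basis are given by definite descriptions, their
    existence is part of the argument: it comes from division with remainder
    ([normal_form]) and from Dickson's lemma ([dickson]). *)

(** * The graded order *)

Section GradedOrder.
Variables (N : nat) (le : rel 'X_{1..N}).
Hypothesis le_term : is_term_order le.

Lemma grlt_irr m : grlt le m m = false.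
Proof. by rewrite /grlt ltnn !eqxx !andbF. Qed.

Lemma grlt_trans m2 m1 m3 : grlt le m1 m2 -> grlt le m2 m3 -> grlt le m1 m3.
Proof.
have [[_ le_anti le_tr _] _] := le_term.
rewrite /grlt => /orP[lt12|/and3P[/eqP-> le12 ne12]]
  /orP[lt23|/and3P[/eqP e23 le23 ne23]].
- by rewrite (ltn_trans lt12 lt23).
- by rewrite -e23 lt12.
- by rewrite lt23.
rewrite e23 eqxx (le_tr _ _ _ le12 le23) /= ; apply/orP; right.
apply: contraNneq ne12 => e13; apply/eqP/le_anti.
by rewrite le12 e13 le23.
Qed.

Lemma grlt_total m1 m2 : m1 != m2 -> grlt le m1 m2 || grlt le m2 m1.
Proof.
have [[_ _ _ le_tot] _] := le_term; move=> ne12.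
rewrite /grlt ne12 (eq_sym m2) ne12 !andbT (eq_sym (mdeg m2)).
by case: ltngtP => //= _; exact: le_tot.
Qed.

Lemma grleW m1 m2 : grlt le m1 m2 -> grle le m1 m2.
Proof. by rewrite /grle orbC => ->. Qed.

Lemma grle_refl m : grle le m m.
Proof. by rewrite /grle eqxx. Qed.

Lemma grle_eqVlt m1 m2 : grle le m1 m2 -> m1 = m2 \/ grlt le m1 m2.
Proof. by case/orP => [/eqP|]; [left|right]. Qed.

Lemma grle_lt_trans m2 m1 m3 : grle le m1 m2 -> grlt le m2 m3 -> grlt le m1 m3.
Proof. by case/grle_eqVlt => [->//|]; exact: grlt_trans. Qed.

Lemma grle_trans m2 m1 m3 : grle le m1 m2 -> grle le m2 m3 -> grle le m1 m3.
Proof.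
by move=> le12 /grle_eqVlt[<-//|lt23]; apply/grleW/(grle_lt_trans le12).
Qed.

Lemma grle_anti m1 m2 : grle le m1 m2 -> grle le m2 m1 -> m1 = m2.
Proof.
move=> /grle_eqVlt[//|lt12] /(fun l => grle_lt_trans l lt12).
by rewrite grlt_irr.
Qed.

Lemma grlt_neq m1 m2 : grlt le m1 m2 -> m1 <> m2.
Proof. by move=> + e; rewrite e grlt_irr. Qed.

Lemma grltNge m1 m2 : ~~ grle le m1 m2 -> grlt le m2 m1.
Proof. by rewrite negb_or => /andP[/grlt_total/orP[->|]]. Qed.

Lemma grle_add m1 m2 m : grle le m1 m2 -> grle le (m1 + m)%MM (m2 + m)%MM.
Proof.
have [_ [_ le_add]] := le_term.
rewrite /grle /grlt !mdegD ltn_add2r eqn_add2r.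
case/orP => [/eqP->|/orP[->|/and3P[-> /le_add-> ne12]]]; rewrite ?eqxx ?orbT //=.
by rewrite orbCA orbN orbT.
Qed.

Lemma cone_grle m1 m2 : cone m1 m2 -> grle le m1 m2.
Proof.
rewrite /cone /= => /submK <-; rewrite -{1}[m1]add0m; apply: grle_add.
by rewrite /grle /grlt mdeg0 lt0n mdeg_eq0 eq_sym; case: eqVneq.
Qed.

(** Because the order is graded, an exponent has only finitely many predecessors:
    they all have at most its degree.  Their number is the induction measure. *)
Lemma grlt_ind (P : 'X_{1..N} -> Prop) :
  (forall m, (forall m', grlt le m' m -> P m') -> P m) -> forall m, P m.
Proof.
move=> IH m; pose D := (mdeg m).+1.
pose mu x := #|[pred y : 'X_{1..N < D} | grlt le (bmnm y) x]|.
suff main s x : (mdeg x < D)%N -> (mu x < s)%N -> P x by exact: (main (mu m).+1).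
elim: s x => // s IHs x ltxD; rewrite ltnS => le_mu; apply: IH => y lt_yx.
have ltyD: (mdeg y < D)%N.
  by case/orP: lt_yx => [/ltn_trans/(_ ltxD)|/and3P[/eqP->]].
apply: IHs => //; apply: leq_trans le_mu; apply: proper_card.
apply/properP; split.
  by apply/fintype.subsetP => z; rewrite !inE => /grlt_trans; apply.
by exists (BMultinom ltyD); rewrite !inE ?grlt_irr.
Qed.

Variable k : fieldType.
Implicit Types (p q f : {mpoly k[N]}) (m : 'X_{1..N}).

Lemma is_lead_uniq f m1 m2 : is_lead le f m1 -> is_lead le f m2 -> m1 = m2.
Proof. by move=> [s1 h1] [s2 h2]; apply: grle_anti; [exact: h2|exact: h1]. Qed.

Lemma is_lead_exists p : p != 0 -> exists m, is_lead le p m.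
Proof.
rewrite -msupp_eq0 /is_lead; elim: (msupp p) => // x s IH _.
have [->|/IH[m [ms mmax]]] := eqVneq s [::].
  by exists x; split=> [|m]; rewrite mem_seq1 // => /eqP->; exact: grle_refl.
have [le_xm|/grltNge/grleW le_mx] := boolP (grle le x m).
  exists m; split=> [|m']; first by rewrite inE ms orbT.
  by rewrite inE => /orP[/eqP->|/mmax].
exists x; split=> [|m']; first by rewrite inE eqxx.
rewrite inE => /orP[/eqP->|/mmax/grle_trans]; first exact: grle_refl.
exact.
Qed.

Lemma is_leadX m : is_lead le ('X_[m] : {mpoly k[N]}) m.
Proof.
split=> [|m']; rewrite msuppX mem_seq1 // => /eqP->; exact: grle_refl.
Qed.

Lemma is_leadMX f m d : is_lead le f m -> is_lead le (f * 'X_[d]) (d + m)%MM.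
Proof.
move=> [fm fmax]; split=> [|m'].
  by rewrite mcoeff_msupp mcoeffMX -mcoeff_msupp.
rewrite (perm_mem (msuppMX _ _)) => /mapP[x /fmax le_xm ->].
by rewrite ![(d + _)%MM]addmC; apply: grle_add.
Qed.

(** One step of division: the leading terms cancel. *)
Lemma cancel_lead p f m : is_lead le p m -> is_lead le f m ->
  forall m', m' \in msupp (p - (p@_m / f@_m) *: f) -> grlt le m' m.
Proof.
move=> [pm pmax] [fm fmax] m'.
rewrite mcoeff_msupp mcoeffB mcoeffZ => nz.
have: grle le m' m.
  have [/pmax//|] := boolP (m' \in msupp p).
  rewrite -mcoeff_eq0 => /eqP p0; apply: fmax; rewrite mcoeff_msupp.
  by apply: contraNneq nz => ->; rewrite p0 mulr0 subrr.
case/grle_eqVlt => // e; move: nz; rewrite e divfK ?subrr ?eqxx //.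
by rewrite -mcoeff_msupp.
Qed.

End GradedOrder.

(** * Reduced representatives modulo an ideal *)

Definition poly_ideal (k : fieldType) (N : nat) (I : set {mpoly k[N]}) : Prop :=
  [/\ I 0, forall p q, I p -> I q -> I (p - q) & forall p q, I q -> I (p * q)].

(** For [I] the vanishing ideal of [S], this is [is_fpoly le S g f] without the
    condition that [g] be the leading exponent: the remaining conditions already
    determine [f], see [reduced_at_uniq]. *)
Definition reduced_at (k : fieldType) (N : nat) (le : rel 'X_{1..N})
    (I : set {mpoly k[N]}) (g : 'X_{1..N}) (f : {mpoly k[N]}) : Prop :=
  [/\ I f, f@_g = 1 &
      forall m, m \in msupp f -> m <> g -> ~ lead_exps le I m].

Section Ideal.
Variables (k : fieldType) (N : nat) (le : rel 'X_{1..N}).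
Hypothesis le_term : is_term_order le.
Variable I : set {mpoly k[N]}.
Hypothesis idI : poly_ideal I.
Implicit Types (p q f : {mpoly k[N]}) (m g : 'X_{1..N}).
Local Notation C := (lead_exps le I).

Lemma idealB p q : I p -> I q -> I (p - q).
Proof. by case: idI => _ + _; apply. Qed.

Lemma idealD p q : I p -> I q -> I (p + q).
Proof.
by move=> Ip Iq; rewrite -[q]opprK -[- q]sub0r; do 2?[apply: idealB => //]; case: idI.
Qed.

Lemma idealZ (c : k) p : I p -> I (c *: p).
Proof. by rewrite -mul_mpolyC; case: idI => _ _; apply. Qed.

Lemma ideal_sum (T : Type) (r : seq T) (P : pred T) (F : T -> {mpoly k[N]}) :
  (forall i, P i -> I (F i)) -> I (\sum_(i <- r | P i) F i).
Proof. by move=> IF; elim/big_ind: _ => //; [case: idI|exact: idealD]. Qed.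

Lemma lead_exps_cone m1 m2 : C m1 -> cone m1 m2 -> C m2.
Proof.
move=> [f [If leadf]] /submK <-; exists (f * 'X_[m2 - m1]); split.
  by rewrite mulrC; case: idI => _ _; apply.
exact: is_leadMX.
Qed.

(** Otherwise the leading exponent of [p] would be an exponent of [p] in [C]. *)
Lemma ideal_eq0 p : I p -> (forall m, m \in msupp p -> ~ C m) -> p = 0.
Proof.
move=> Ip pD; apply/eqP/negP => /negP/(is_lead_exists le_term)[m leadm].
by apply: (pD m); [case: leadm|exists p].
Qed.

(** Division with remainder [p - q]: the leading term of [p] is put in the
    remainder if its exponent lies outside [C], and otherwise cancelled by an
    element of [I]. *)
Lemma normal_form g p : (forall m, m \in msupp p -> grlt le m g) ->
  exists q, [/\ I q, forall m, m \in msupp q -> grlt le m g &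
    forall m, m \in msupp (p - q) -> ~ C m].
Proof.
elim/(grlt_ind le_term): g p => g IH p p_lt.
have [->|nzp] := eqVneq p 0.
  by exists 0; split=> [|m|m]; rewrite ?subr0 ?msupp0 //; case: idI.
have [m leadp] := is_lead_exists le_term nzp.
have lt_mg : grlt le m g by case: leadp => /p_lt.
have [Cm|nCm] := pselect (C m).
  have [f [If leadf]] := Cm.
  have [q [Iq q_lt qC]] := IH m lt_mg _ (cancel_lead leadp leadf).
  exists ((p@_m / f@_m) *: f + q); split.
  - by apply: idealD => //; exact: idealZ.
  - move=> m' /msuppD_le; rewrite mem_cat => /orP[/msuppZ_le|/q_lt].
      by case: leadf => _ fmax /fmax /(grle_lt_trans le_term); apply.
    by move=> /(grlt_trans le_term); apply.
  - by rewrite opprD addrA.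
have leadX := is_leadX le k m.
have [q [Iq q_lt qC]] := IH m lt_mg _ (cancel_lead leadp leadX).
exists q; split=> // [m' /q_lt/(grlt_trans le_term)|m']; first exact.
rewrite -[p in p - q](subrK ((p@_m / ('X_[m])@_m) *: 'X_[m])) addrAC.
move=> /msuppD_le; rewrite mem_cat => /orP[/qC//|/msuppZ_le].
by rewrite msuppX mem_seq1 => /eqP->.
Qed.

(** If [c *: f] in [I] is monic with leading exponent [g], and dividing
    ['X_[g] - c *: f] with remainder gives [q] in [I], then [c *: f + q] is ['X_[g]]
    minus the remainder. *)
Lemma reduced_at_exists g : C g -> exists f, reduced_at le I g f /\ is_lead le f g.
Proof.
move=> [f [If leadf]].
have nzfg : f@_g != 0 by case: leadf => + _; rewrite mcoeff_msupp.
have /normal_form[q [Iq q_lt qC]] := cancel_lead (is_leadX le k g) leadf.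
set c := _ / _ in qC.
have nzc : c != 0 by rewrite /c mcoeffX eqxx mul1r invr_eq0.
have q0 : q@_g = 0.
  by apply/eqP; rewrite mcoeff_eq0; apply/negP => /q_lt; rewrite grlt_irr.
have rE : c *: f + q = 'X_[g] - ('X_[g] - c *: f - q).
  by rewrite 2!opprB [q + _]addrA [RHS]addrC subrK addrC.
have rC m : m \in msupp (c *: f + q) -> m <> g -> ~ C m.
  move=> + /nesym/eqP/negPf ne; rewrite rE mcoeff_msupp mcoeffB mcoeffX ne.
  by rewrite sub0r oppr_eq0 -mcoeff_msupp; exact: qC.
exists (c *: f + q); split; first split=> //.
- by apply: idealD => //; exact: idealZ.
- by rewrite mcoeffD mcoeffZ q0 addr0 /c mcoeffX eqxx divfK.
split=> [|m].
  by rewrite mcoeff_msupp mcoeffD mcoeffZ q0 addr0 mulf_neq0.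
move=> /msuppD_le; rewrite mem_cat => /orP[/msuppZ_le|/q_lt/grleW//].
by case: leadf => _; apply.
Qed.

(** The terms at [g] cancel in the difference. *)
Lemma reduced_at_uniq g f1 f2 :
  reduced_at le I g f1 -> reduced_at le I g f2 -> f1 = f2.
Proof.
move=> [I1 f1g f1D] [I2 f2g f2D]; apply/eqP; rewrite -subr_eq0; apply/eqP.
apply: ideal_eq0; first exact: idealB.
move=> m; have [->|ne] := eqVneq m g.
  by rewrite mcoeff_msupp mcoeffB f1g f2g subrr eqxx.
by move=> /msuppB_le; rewrite mem_cat => /orP[/f1D|/f2D]; apply; apply/eqP.
Qed.

End Ideal.

(** * Existence of reduced Groebner bases *)

(** Dickson's lemma restricted to the first [r] coordinates, by induction on [r].
    Take a finite [B0] that works for [r] coordinates and let [M] bound the next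
    coordinate on [B0].  A point whose next coordinate is at least [M] is still
    dominated by [B0]; the others lie in finitely many slices on which that
    coordinate is constant, and the induction hypothesis applies to each. *)
Lemma dickson_prefix (N r : nat) (E : set 'X_{1..N}) :
  exists B : seq 'X_{1..N}, (forall b, b \in B -> E b) /\
    forall m, E m -> exists2 b, b \in B &
      forall i : 'I_N, (i < r)%N -> (b i <= m i)%N.
Proof.
elim: r E => [|r IH] E.
  have [[m Em]|noE] := pselect (exists m, E m).
    exists [:: m]; split=> [b|m' _]; first by rewrite mem_seq1 => /eqP->.
    by exists m; rewrite ?mem_head.
  by exists [::]; split=> // m Em; case: noE; exists m.
have [ltrN|leNr] := ltnP r N; last first.
  have [B [BE Bdom]] := IH E; exists B; split=> // m /Bdom[b Bb le_bm].
  by exists b => // i _; apply: le_bm; apply: leq_trans leNr.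
pose o := Ordinal ltrN.
have [B0 [B0E B0dom]] := IH E.
have /choice[B Bslice] j := IH [set m | E m /\ m o = j].
pose M := \max_(b <- B0) b o.
exists (B0 ++ flatten [seq B j | j <- iota 0 M]); split=> [b|m Em].
  rewrite mem_cat => /orP[/B0E//|/flatten_mapP[j _ bBj]].
  by have [/(_ b bBj)[]] := Bslice j.
have [leMm|ltmM] := leqP M (m o).
  have [b bB0 le_bm] := B0dom m Em; exists b; first by rewrite mem_cat bB0.
  move=> i; rewrite ltnS leq_eqVlt => /orP[/eqP e|/le_bm//].
  have ->: i = o by exact: val_inj.
  by apply: leq_trans leMm; rewrite /M (big_rem b) //= leq_maxl.
have [BE Bdom] := Bslice (m o).
have [b bB le_bm] := Bdom m (conj Em erefl).
exists b.
  rewrite mem_cat; apply/orP; right; apply/flatten_mapP.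
  by exists (m o) => //; rewrite mem_iota.
move=> i; rewrite ltnS leq_eqVlt => /orP[/eqP e|/le_bm//].
have ->: i = o by exact: val_inj.
by have [_ ->] := BE b bB.
Qed.

Lemma dickson (N : nat) (E : set 'X_{1..N}) :
  exists B : seq 'X_{1..N}, (forall b, b \in B -> E b) /\
    forall m, E m -> exists2 b, b \in B & cone b m.
Proof.
have [B [BE Bdom]] := dickson_prefix N E; exists B; split=> // m /Bdom[b bB le_bm].
by exists b => //; apply/mnm_lepP => i; exact: le_bm.
Qed.

Definition cone_minimal (N : nat) (E : set 'X_{1..N}) (b : 'X_{1..N}) : Prop :=
  E b /\ forall m, E m -> cone m b -> m = b.

(** Divisibility of exponents is well-founded since it increases the degree. *)
Lemma cone_minimal_below (N : nat) (E : set 'X_{1..N}) (m : 'X_{1..N}) :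
  E m -> exists2 b, cone_minimal E b & cone b m.
Proof.
have [s] := ubnP (mdeg m); elim: s m => // s IHs m; rewrite ltnS => lt_ms Em.
have [minm|] := pselect (cone_minimal E m).
  by exists m => //; exact: lepm_refl.
move=> /not_andP[//|/existsNP[m' /not_implyP[Em' /not_implyP[m'm ne]]]].
have lt_m' : (mdeg m' < mdeg m)%N.
  rewrite -(submK m'm) mdegD -[X in (X < _)%N]add0n ltn_add2r lt0n mdeg_eq0.
  by apply: contra_notN ne => /eqP e; rewrite -(submK m'm) e add0m.
have [b minb bm'] := IHs m' (leq_trans lt_m' lt_ms) Em'.
by exists b => //; exact: (lepm_trans bm').
Qed.

Section Groebner.
Variables (k : fieldType) (N : nat) (le : rel 'X_{1..N}).
Hypothesis le_term : is_term_order le.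
Variable I : set {mpoly k[N]}.
Hypothesis idI : poly_ideal I.
Local Notation C := (lead_exps le I).

(** The reduced representatives at the minimal elements of [C] form a reduced
    basis; Dickson's lemma makes these elements finite in number, since any finite
    set that generates [C] contains them all. *)
Lemma reduced_groebner_basis_exists :
  exists G : {fset {mpoly k[N]}}, is_reduced_groebner_basis le I G.
Proof.
have [B [BC Bdom]] := dickson C.
have /choice[F FP] m : exists f, C m -> reduced_at le I m f /\ is_lead le f m.
  have [Cm|] := pselect (C m); last by exists 0.
  by have [f] := reduced_at_exists le_term idI Cm; exists f.
pose G := [fset F b | b in [seq b <- B | `[< cone_minimal C b >]]]%fset.
have GP g : g \in G -> exists2 b, cone_minimal C b & g = F b.
  move=> /imfsetP[b /=]; rewrite mem_filter => /andP[/asboolP minb _] ->.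
  by exists b.
exists G; split; first split.
- move=> g /GP[b [/FP[[Ig _ _] [gb _]] _] ->]; split=> //.
  by apply: contraTneq gb => ->; rewrite msupp0.
- move=> m /cone_minimal_below[b minb bm].
  have [Cb bmin] := minb; have [b' b'B b'b] := Bdom b Cb.
  exists (F b), b; split=> //; last by have [] := FP b Cb.
  apply/imfsetP; exists b => //=.
  rewrite mem_filter; apply/andP; split; first exact/asboolP.
  by rewrite -(bmin b' (BC _ b'B) b'b).
- move=> g mg /GP[b [/FP[[_ gb1 _] leadb] _] ->] /(is_lead_uniq le_term leadb) <-.
  exact: gb1.
- move=> g g' mg' m /GP[b [Cb bmin] ->] /GP[b' [Cb' bmin'] ->] ne leadg' mg cm.
  have [_ leadb'] := FP b' Cb'.
  have e := is_lead_uniq le_term leadb' leadg'; rewrite -e in cm.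
  have [[_ _ redb] leadb] := FP b Cb.
  have [em|nem] := eqVneq m b; last first.
    by apply: (redb m mg); [apply/eqP|exact: (lead_exps_cone le_term idI) cm].
  by move: ne; rewrite (bmin b' Cb') ?eqxx // -em.
Qed.

(** Reducedness of the basis only keeps the exponents of [g] out of the cones over
    the leading exponents of the other elements.  But an exponent of [g] in the cone
    over its own leading exponent [m] is at least [m] for the order, hence equals
    [m]. *)
Lemma reduced_groebner_basis_reduced_at G g m :
  is_reduced_groebner_basis le I G -> g \in G -> is_lead le g m ->
  reduced_at le I m g.
Proof.
move=> [[GI GC] Gmonic Gred] gG leadg.
split; [by have [] := GI g gG|exact: Gmonic|].
move=> m' gm' ne /GC[g' [mg' [g'G leadg' cm']]].
have [eg|neg] := eqVneq g g'; last exact: (Gred g g' mg' m' gG g'G neg leadg' gm').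
apply: ne; rewrite -eg in leadg'.
rewrite -(is_lead_uniq le_term leadg leadg') in cm'.
by apply: (grle_anti le_term); [case: leadg => _; apply|exact: cone_grle].
Qed.

End Groebner.

(** * Vanishing ideals of finite sets of points *)

Section Vanishing.
Variables (k : fieldType) (n : nat).
Implicit Types (S A : {fset proj_point k n}) (p : {mpoly k[n.+1]}).

Lemma vanishing_ideal_ideal S : poly_ideal (vanishing_ideal S).
Proof.
split=> [L _|p q Ip Iq L LS|p q Iq L LS]; rewrite /vanishing_ideal /=.
- exact: raddf0.
- by rewrite raddfB /= Ip // Iq // subr0.
- by rewrite rmorphM /= Iq // mulr0.
Qed.

(** The coefficient of t^d in p(ta) is the value at a of the degree-d component of
    p; this is what makes the vanishing ideal homogeneous. *)
Lemma mmap_line_pihomog (a : 'I_n.+1 -> k) d p :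
  mmap (@polyC k) (fun i => a i *: 'X) (pihomog mdeg d p) =
  (mmap (@polyC k) (fun i => a i *: 'X) p)`_d *: 'X^d.
Proof.
have mmX m : mmap1 (fun i => a i *: 'X) m =
    (\prod_i a i ^+ m i) *: 'X^(mdeg m) :> {poly k}.
  rewrite /mmap1 (eq_bigr (fun i => (a i ^+ m i)%:P * 'X^(m i))); last first.
    by move=> i _; rewrite exprZn mul_polyC.
  by rewrite big_split /= -rmorph_prod mul_polyC mdegE expr_sum.
rewrite pihomogE raddf_sum /= [in RHS]/mmap coef_sum scaler_suml.
rewrite big_mkcond /=; apply: eq_bigr => m _.
rewrite mmX mul_polyC !coefZ coefXn eq_sym; case: eqP => [->|_].
  by rewrite mmapZ mmapX mmX mulr1 mul_polyC scalerA.
by rewrite !mulr0 scale0r.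
Qed.

Lemma vanishing_ideal_pihomog S d p :
  vanishing_ideal S p -> vanishing_ideal S (pihomog mdeg d p).
Proof.
by move=> Ip L LS; rewrite mmap_line_pihomog (Ip L LS) coef0 scale0r.
Qed.

Lemma vanishing_ideal_split A p : vanishing_ideal A p <->
  vanishing_ideal (points_X1_eq0 A) p /\ vanishing_ideal (points_X1_neq0 A) p.
Proof.
split=> [Ip|[I0 I1] L LA].
  by split=> L; rewrite !inE /= => /andP[LA LA']; apply: Ip.
have [LA1|LA1] := boolP (L \in points_X1_neq0 A); first exact: I1.
by apply: I0; rewrite in_fsetD LA1.
Qed.

End Vanishing.

Lemma mcoeff_pihomog (k : fieldType) (N d : nat) (p : {mpoly k[N]}) m :
  (pihomog mdeg d p)@_m = if mdeg m == d then p@_m else 0.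
Proof.
rewrite pihomogE raddf_sum /=.
have [e|ne] := eqVneq (mdeg m) d; last first.
  rewrite big1 // => m' /eqP e; rewrite mcoeffZ mcoeffX.
  by case: eqP => [e'|]; rewrite ?mulr0 //; rewrite -e' e eqxx in ne.
rewrite [in RHS](mpolyE p) raddf_sum /= [RHS](bigID (fun m' => mdeg m' == d)) /=.
rewrite [X in _ = _ + X]big1 ?addr0 // => m' ne.
rewrite mcoeffZ mcoeffX; case: eqP => [e'|]; rewrite ?mulr0 //.
by rewrite e' e eqxx in ne.
Qed.

(** * The polynomials of a point set and the recursion *)

Section PointSet.
Variables (k : fieldType) (n : nat) (le : rel 'X_{1..n.+1}).
Hypothesis le_term : is_term_order le.
Implicit Types (S A : {fset proj_point k n}) (m g d : 'X_{1..n.+1}).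

Lemma fpolyP S g : script_C le S g -> is_fpoly le S g (fpoly le S g).
Proof.
move=> Cg; apply: xgetPex.
have [f [[If f1 fD] leadf]] :=
  reduced_at_exists le_term (vanishing_ideal_ideal S) Cg.
by exists f; split.
Qed.

Lemma mcoeff_fpoly S g m : script_C le S g -> script_C le S m ->
  (fpoly le S g)@_m = (g == m)%:R.
Proof.
move=> Cg Cm; have [_ _ f1 fD] := fpolyP Cg.
have [<-|ne] := eqVneq g m; first by rewrite f1.
apply/eqP; rewrite mcoeff_eq0; apply/negP => /fD; apply=> //.
by apply/eqP; rewrite eq_sym.
Qed.

Lemma mcoeff_lower_sum S g (c : 'X_{1..n.+1} -> k) m : script_C le S m ->
  (lower_sum le S g c)@_m = if `[< lower_exps le S g m >] then c m else 0.
Proof.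
move=> Cm; rewrite /lower_sum raddf_sum /=.
case: asboolP => [lowm|nlowm]; last first.
  rewrite big1 // => d /asboolP lowd.
  rewrite mcoeffZ mcoeff_fpoly //; last by case: lowd.
  by case: eqP => [e|]; rewrite ?mulr0 //; rewrite e in lowd.
have ltm : (mdeg m < (mdeg g).+1)%N by case: lowm => _ ->.
rewrite (bigD1 (BMultinom ltm)) /=; last exact/asboolP.
rewrite mcoeffZ mcoeff_fpoly // eqxx mulr1 big1 ?addr0 //.
move=> d /andP[/asboolP lowd ne].
rewrite mcoeffZ mcoeff_fpoly //; last by case: lowd.
by rewrite -val_eqE /= in ne; rewrite (negPf ne) mulr0.
Qed.

Lemma msupp_lower_sum S g c m : m \in msupp (lower_sum le S g c) -> grlt le m g.
Proof.
move=> sm.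
have [d lowd dm] : exists2 d, lower_exps le S g d & m \in msupp (fpoly le S d).
  apply: contrapT => no; move: sm; rewrite mcoeff_msupp raddf_sum /= big1 ?eqxx //.
  move=> d /asboolP lowd; rewrite mcoeffZ; apply/eqP; rewrite mulf_eq0 mcoeff_eq0.
  by apply/orP; right; apply/negP => dm; apply: no; exists (bmnm d).
have [Cd _ lt_dg] := lowd; have [_ [_ /(_ m dm) le_md] _ _] := fpolyP Cd.
exact: (grle_lt_trans le_term le_md).
Qed.

Lemma vanishing_lower_sum S g c : vanishing_ideal S (lower_sum le S g c).
Proof.
have idS := vanishing_ideal_ideal S.
apply: (ideal_sum idS) => d /asboolP[Cd _ _]; apply: (idealZ idS).
by have [] := fpolyP Cd.
Qed.

(** The difference of the two sides lies in the ideal and has coefficient [0] at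
    every leading exponent of the ideal. *)
Lemma lower_expansion S g p : script_C le S g -> vanishing_ideal S p -> p@_g = 1 ->
  (forall m, m \in msupp p -> m <> g -> mdeg m = mdeg g /\ grlt le m g) ->
  p = fpoly le S g + lower_sum le S g (fun m => p@_m).
Proof.
move=> Cg Ip p1 p_lt; have idS := vanishing_ideal_ideal S.
apply/eqP; rewrite -subr_eq0; apply/eqP.
apply: (@ideal_eq0 _ _ _ le_term (vanishing_ideal S)).
  apply: (idealB idS Ip); apply: (idealD idS); last exact: vanishing_lower_sum.
  by have [] := fpolyP Cg.
move=> m + Cm; rewrite mcoeff_msupp mcoeffB mcoeffD.
rewrite mcoeff_fpoly // mcoeff_lower_sum //.
have [<-|ne] := eqVneq g m.
  case: asboolP => [[_ _]|_]; first by rewrite grlt_irr.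
  by rewrite p1 addr0 subrr eqxx.
rewrite add0r; case: asboolP => [_|nlow]; first by rewrite subrr eqxx.
rewrite subr0 -mcoeff_msupp => pm; apply: nlow.
by have [] := p_lt m pm; [apply/eqP; rewrite eq_sym|split].
Qed.

Lemma script_GP A : is_reduced_groebner_basis le (vanishing_ideal A) (script_G le A).
Proof.
apply: xgetPex.
exact: (reduced_groebner_basis_exists le_term (vanishing_ideal_ideal A)).
Qed.

Lemma script_B_below A m : script_C le A m -> exists2 b, script_B le A b & cone b m.
Proof.
have [[_ GC] _ _] := script_GP A.
by move=> /GC[g [b [gG leadg bm]]]; exists b => //; exists g.
Qed.

Lemma script_C_split A m : script_C le A m ->
  script_C le (points_X1_eq0 A) m /\ script_C le (points_X1_neq0 A) m.
Proof.
by move=> [f [/vanishing_ideal_split[I0 I1] leadf]]; split; exists f.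
Qed.

Lemma script_B_C A m : script_B le A m -> script_C le A m.
Proof.
have [[GI _] _ _] := script_GP A.
by move=> [g [gG leadg]]; exists g; split=> //; have [] := GI g gG.
Qed.

Lemma cprime_stage_sub A E m : cprime_stage le A E -> E m ->
  script_C le (points_X1_eq0 A) m /\ script_C le (points_X1_neq0 A) m.
Proof. by elim=> // {}E g _ IH _ _ [/IH]. Qed.

(** An element of [script_B le A] is never removed as a single point, so it leaves
    as part of some cone, and its own cone is contained in that one. *)
Lemma cprime_stage_cone A E xi : cprime_stage le A E -> script_B le A xi ->
  ~ E xi -> forall m, E m -> ~ cone xi m.
Proof.
move=> stage Bxi; elim: stage => [|{}E g _ IH _ Bg|{}E g _ IH _ nBg] nE m.
- by case: nE; exact: script_C_split (script_B_C Bxi).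
- move=> [Em ngm] xim.
  have [Exi|nExi] := pselect (E xi); last exact: (IH nExi m Em).
  by apply: nE; split=> // gxi; apply: ngm; exact: (lepm_trans gxi).
- move=> [Em _]; apply: IH => // Exi; apply: nE; split=> // e.
  by rewrite /= in e; rewrite -e in nBg.
Qed.

(** Let [xi] in [script_B le A] divide the minimum [g].  If [xi] differs from [g],
    it is smaller, so it has left the set, and by [cprime_stage_cone] its cone,
    which contains [g], has left with it. *)
Lemma cprime_min_script_B A E g : cprime_stage le A E -> is_gr_min le E g ->
  script_C le A g -> script_B le A g.
Proof.
move=> stage [Eg gmin] /script_B_below[xi Bxi xig].
have [<-//|ne] := eqVneq xi g.
have nExi : ~ E xi.
  move=> /gmin le_gxi; move/eqP: ne; apply.
  exact: (grle_anti le_term (cone_grle le_term xig)).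
by case: (cprime_stage_cone stage Bxi nExi Eg).
Qed.

(** A reduced basis element is homogeneous: the rest of it after removal of the
    component containing the leading term lies in the ideal and has no exponent
    in [script_C le A]. *)
Lemma script_G_homog A g f m : f \in script_G le A -> is_lead le f g ->
  m \in msupp f -> mdeg m = mdeg g.
Proof.
move=> fG leadf fm; have idA := vanishing_ideal_ideal A.
have [If f1 fD] := reduced_groebner_basis_reduced_at le_term (script_GP A) fG leadf.
have r0 : f - pihomog mdeg (mdeg g) f = 0.
  apply: (@ideal_eq0 _ _ _ le_term (vanishing_ideal A)).
    by apply: (idealB idA If); exact: vanishing_ideal_pihomog.
  move=> m'; rewrite mcoeff_msupp mcoeffB mcoeff_pihomog.
  have [_|ne] := eqVneq (mdeg m') (mdeg g); first by rewrite subrr eqxx.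
  by rewrite subr0 -mcoeff_msupp => /fD; apply => e; rewrite e eqxx in ne.
apply/eqP; move: fm; rewrite mcoeff_msupp (subr0_eq r0) mcoeff_pihomog.
by case: (mdeg m == _) => //; rewrite eqxx.
Qed.

(** Both unknown coefficient families are the coefficients of the basis element
    with leading exponent [g]. *)
Lemma script_B_solution A g : script_B le A g ->
  exists c d : 'X_{1..n.+1} -> k, is_solution le A g c d.
Proof.
move=> Bg; have [C0g C1g] := script_C_split (script_B_C Bg).
have [f [fG leadf]] := Bg.
have [If f1 fD] := reduced_groebner_basis_reduced_at le_term (script_GP A) fG leadf.
have [I0f I1f] := (vanishing_ideal_split A f).1 If.
have f_lt m : m \in msupp f -> m <> g -> mdeg m = mdeg g /\ grlt le m g.
  move=> fm ne; split; first exact: (script_G_homog fG leadf).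
  by case: leadf => _ /(_ m fm)/grle_eqVlt[].
exists (fun m => f@_m), (fun m => f@_m); split.
  apply/eqP; rewrite subr_eq addrAC eq_sym subr_eq.
  rewrite -(lower_expansion C0g I0f f1 f_lt) addrC.
  by rewrite -(lower_expansion C1g I1f f1 f_lt).
have f0 xi m : script_B le A xi -> grlt le m g -> cone xi m -> f@_m = 0.
  move=> Bxi lt_mg xim; apply/eqP; rewrite mcoeff_eq0; apply/negP => /fD.
  apply; first exact: (grlt_neq lt_mg).
  exact: (lead_exps_cone le_term (vanishing_ideal_ideal A) (script_B_C Bxi)).
by move=> xi Bxi _; split=> m [_ _ lt_mg]; exact: f0.
Qed.

(** The right-hand expression [f_E] puts [f] in the ideal of the points with
    nonzero X_1.  At an exponent other than [g] in [script_C le A] the coefficient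
    of [f] is zero, or the value of [c] if the exponent is in [lower_exps]; and the
    side conditions force that value to be zero too. *)
Lemma solution_reduced_at A g (c d : 'X_{1..n.+1} -> k) :
  script_C le (points_X1_eq0 A) g -> script_C le (points_X1_neq0 A) g ->
  is_solution le A g c d ->
  let f := fpoly le (points_X1_eq0 A) g + lower_sum le (points_X1_eq0 A) g c in
  reduced_at le (vanishing_ideal A) g f /\ is_lead le f g.
Proof.
move=> C0g C1g [eq0 c0] f.
have f_E : f = fpoly le (points_X1_neq0 A) g + lower_sum le (points_X1_neq0 A) g d.
  rewrite /f -[fpoly _ _ g in LHS](subrK (fpoly le (points_X1_neq0 A) g)) eq0.
  by rewrite addrAC subrK addrC.
have I_sum S b : script_C le S g ->
    vanishing_ideal S (fpoly le S g + lower_sum le S g b).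
  move=> Cg; apply: (idealD (vanishing_ideal_ideal S)); last first.
    exact: vanishing_lower_sum.
  by have [] := fpolyP Cg.
have fg : f@_g = 1.
  rewrite mcoeffD mcoeff_fpoly // eqxx mcoeff_lower_sum //.
  by case: asboolP => [[_ _]|_]; rewrite ?grlt_irr ?addr0.
split; first split=> //.
- by apply/vanishing_ideal_split; split; [exact: I_sum|rewrite f_E; exact: I_sum].
- move=> m + ne CAm; have [C0m _] := script_C_split CAm.
  rewrite mcoeff_msupp mcoeffD mcoeff_fpoly // mcoeff_lower_sum //.
  have /negPf-> : g != m by apply/eqP => /esym.
  rewrite add0r; case: asboolP => [lowm|_]; last by rewrite eqxx.
  have [xi Bxi xim] := script_B_below CAm; have [_ _ lt_mg] := lowm.
  have lt_xig := grle_lt_trans le_term (cone_grle le_term xim) lt_mg.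
  by rewrite ((c0 xi Bxi lt_xig).1 m) ?eqxx.
- split=> [|m]; first by rewrite mcoeff_msupp fg oner_neq0.
  move=> /msuppD_le; rewrite mem_cat => /orP[|/msupp_lower_sum/grleW//].
  by have [_ [_ + ] _ _] := fpolyP C0g; apply.
Qed.

(** The polynomial of a solution and the basis element with leading exponent [g]
    are both reduced at [g], hence equal. *)
Lemma solution_script_G A E g (c d : 'X_{1..n.+1} -> k) :
  cprime_stage le A E -> is_gr_min le E g ->
  script_C le (points_X1_eq0 A) g -> script_C le (points_X1_neq0 A) g ->
  is_solution le A g c d ->
  script_B le A g /\
  fpoly le (points_X1_eq0 A) g + lower_sum le (points_X1_eq0 A) g c \in script_G le A.
Proof.
move=> stage ming C0g C1g /(solution_reduced_at C0g C1g) /=.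
set f := _ + _ => -[redf leadf].
have Bg : script_B le A g.
  by apply: (cprime_min_script_B stage ming); exists f; split=> //; case: redf.
split=> //; have [h [hG leadh]] := Bg.
have redh := reduced_groebner_basis_reduced_at le_term (script_GP A) hG leadh.
by rewrite (reduced_at_uniq le_term (vanishing_ideal_ideal A) redf redh).
Qed.

End PointSet.

Theorem lemma6 (k : fieldType) (n : nat) (A : {fset proj_point k n})
    (le : rel 'X_{1..n.+1})
    (le_term : is_term_order le) (le_vars : increasing_variables le)
    (C' : set 'X_{1..n.+1}) (hC' : cprime_stage le A C')
    (gamma : 'X_{1..n.+1}) (hgamma : is_gr_min le C' gamma) :
  (script_B le A gamma <->
     exists c d : 'X_{1..n.+1} -> k, is_solution le A gamma c d) /\
  (forall c d : 'X_{1..n.+1} -> k, is_solution le A gamma c d ->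
     fpoly le (points_X1_eq0 A) gamma + lower_sum le (points_X1_eq0 A) gamma c
       \in script_G le A).
Proof.
have [C0g C1g] := cprime_stage_sub hC' hgamma.1.
have sol c d (cd : is_solution le A gamma c d) :=
  solution_script_G le_term hC' hgamma C0g C1g cd.
split; last by move=> c d /sol[].
by split=> [/(script_B_solution le_term)//|[c [d /sol[]]]].
Qed.
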